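(* Let $m\ge1$, $h\ge1$, $I=\{1,\dots,m\}$, $H=\{0,\dots,h-1\}$, $p^t>0$ and $x^{0t}\ge0$ for $t\in H$, $\gamma^i>0$ for $i\in I$, and suppose the sets $X^i$, $i\in I$, are nonempty and compact. Then the game with pay-offs $f(\cdot,x^{-i})$ and constraint sets $X^i$, $i\in I$, admits a unique Nash equilibrium, and this equilibrium is the (unique) minimizer of $$\min_{\{x^i\in X^i\}_{i\in I}}\ f_0(x)+\sum_{i\in I}\big[f(x^i,x^{-i})+f_a(x^i)\big].$$
   Context: Agent $i\in I$ has decision vector $x^i=(x^{it})_{t\in H}\in\mathbb{R}^h$ and constraint set $$X^i=\Big\{x^i\in\mathbb{R}^h:\ \sum_{t\in H}x^{it}=\gamma^i,\ x^{it}\in[\underline{x}^{it},\overline{x}^{it}]\ \forall t\in H\Big\},\qquad \underline{x}^{it}\ge0,\ \overline{x}^{it}<\infty .$$ Write $x=(x^1,\dots,x^m)\in X=X^1\times\dots\times X^m$ and let $x^{-i}$ denote the decisions of all agents other than $i$; $x$ is also written $(x^i,x^{-i})$. Define $$f(x^i,x^{-i})=\sum_{t\in H}x^{it}p^t\Big(\sum_{j\in I,\,j\ne i}x^{jt}+x^{it}+x^{0t}\Big),$$ $$f_0(x)=\sum_{t\in H}x^{0t}p^t\Big(\sum_{j\in I}x^{jt}+x^{0t}\Big),\qquad f_a(x^i)=\sum_{t\in H}p^t(x^{it})^2 .$$ A Nash equilibrium is a point $x\in X$ with $f(x^i,x^{-i})\le f(\zeta^i,x^{-i})$ for all $\zeta^i\in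 X^i$ and all $i\in I$. *)

(* Defs.v *)
From mathcomp Require Import all_boot all_order all_algebra.
From mathcomp Require Import all_classical all_reals all_analysis.

Set Implicit Arguments.
Unset Strict Implicit.
Unset Printing Implicit Defensive.

Import Order.TTheory GRing.Theory Num.Theory.
Import numFieldNormedType.Exports.

Local Open Scope classical_set_scope.
Local Open Scope ring_scope.

(* A decision vector is a row vector indexed by the time steps; a joint decision
   of the m agents is the matrix [x] whose [row i x] is the vector of agent i. *)

Definition agent_set (R : realType) (h : nat) (gamma : R)
    (lo hi : 'I_h -> R) : set 'rV[R]_h :=
  [set v | \sum_t v 0 t = gamma /\ forall t, lo t <= v 0 t <= hi t].

Definition joint_set (R : realType) (m h : nat)
    (X : 'I_m -> set 'rV[R]_h) : set 'M[R]_(m, h) :=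
  [set x | forall i, X i (row i x)].

(* [payoff p x0 i v x] is f(v, x^{-i}): the sum over [j != i] ignores row [i]
   of [x]. *)
Definition payoff (R : realType) (m h : nat) (p : 'I_h -> R) (x0 : 'rV[R]_h)
    (i : 'I_m) (v : 'rV[R]_h) (x : 'M[R]_(m, h)) : R :=
  \sum_t v 0 t * (p t * (\sum_(j | j != i) x j t + v 0 t + x0 0 t)).

Definition payoff0 (R : realType) (m h : nat) (p : 'I_h -> R) (x0 : 'rV[R]_h)
    (x : 'M[R]_(m, h)) : R :=
  \sum_t x0 0 t * (p t * (\sum_j x j t + x0 0 t)).

Definition augment (R : realType) (h : nat) (p : 'I_h -> R)
    (v : 'rV[R]_h) : R :=
  \sum_t p t * v 0 t ^+ 2.

Definition objective (R : realType) (m h : nat) (p : 'I_h -> R)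
    (x0 : 'rV[R]_h) (x : 'M[R]_(m, h)) : R :=
  payoff0 p x0 x + \sum_i (payoff p x0 i (row i x) x + augment p (row i x)).

(* [u i v x] is the cost to agent i of playing [v] against the other rows
   of [x]; agents minimize. *)
Definition nash_equilibrium (R : realType) (m h : nat)
    (u : 'I_m -> 'rV[R]_h -> 'M[R]_(m, h) -> R)
    (X : 'I_m -> set 'rV[R]_h) (x : 'M[R]_(m, h)) : Prop :=
  joint_set X x /\
  forall (i : 'I_m) (z : 'rV[R]_h), X i z -> u i (row i x) x <= u i z x.

Definition minimizer (R : realType) (T : Type) (g : T -> R) (A : set T)
    (x : T) : Prop :=
  A x /\ forall y, A y -> g x <= g y.

(* Main.v *)
Require Import Defs.
From mathcomp Require Import all_boot all_order all_algebra.
From mathcomp Require Import all_classical all_reals all_analysis.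
From mathcomp Require Import ring lra.

Set Implicit Arguments.
Unset Strict Implicit.
Unset Printing Implicit Defensive.

Import Order.TTheory GRing.Theory Num.Theory.
Import numFieldNormedType.Exports.
Local Open Scope classical_set_scope.
Local Open Scope ring_scope.

(** The game is a potential game: writing [S t] for the total load at time [t],
    the social objective is [\sum_t p t * (S t ^+ 2 + \sum_i x i t ^+ 2)], and
    its partial gradient with respect to the decision of agent [i] is twice the
    gradient of the pay-off of agent [i].  Both the equilibria and the minimizers
    are therefore the solutions of one variational inequality, and the solution
    exists and is unique because the objective is continuous and strictly
    convex on a compact set. *)

(** Divide by [e] and let [e] tend to 0. This turns optimality along a segment into a first-order
    condition. *)
Lemma linear_part_ge0 (R : realFieldType) (a b : R) :
  (forall e, 0 < e <= 1 -> 0 <= e * a + e ^+ 2 * b) -> 0 <= a.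
Proof.
move=> H; rewrite leNgt; apply/negP => a_lt0.
have b_ge0 : 0 <= `|b| by exact: normr_ge0.
have c_gt0 : 0 < - a + `|b| by lra.
(* With this step size [a + e * |b| = e * a], which is negative when [a] is. *)
pose e := - a / (- a + `|b|).
have ec : e * (- a + `|b|) = - a by rewrite divfK// gt_eqF.
have e_gt0 : 0 < e by rewrite divr_gt0// oppr_gt0.
have e_le1 : e <= 1 by rewrite ler_pdivrMr//; lra.
have /H : 0 < e <= 1 by rewrite e_gt0.
apply/negP; rewrite -ltNge.
have -> : e * a + e ^+ 2 * b = e * (a + e * b) by ring.
rewrite pmulr_rlt0//.
have : e * b <= e * `|b| by rewrite ler_pM2l// ler_norm.
have : 0 < e * - a by rewrite mulr_gt0// oppr_gt0.
lra.
Qed.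

(** Convexity, with [e] in the range used by [linear_part_ge0]. *)
Definition segment_closed (R : realType) (h : nat) (A : set 'rV[R]_h) : Prop :=
  forall v w e, 0 < e <= 1 -> A v -> A w -> A (v + e *: (w - v)).

Lemma segment_closed_agent_set (R : realType) (h : nat) (gamma : R)
  (lo hi : 'I_h -> R) : segment_closed (agent_set gamma lo hi).
Proof.
move=> v w e /andP[e_gt0 e_le1] [sv bv] [sw bw]; split.
  under eq_bigr do rewrite !mxE.
  by rewrite big_split/= -mulr_sumr sumrB sv sw; ring.
move=> t; rewrite !mxE.
have /andP[v1 v2] := bv t; have /andP[w1 w2] := bw t.
by apply/andP; split; nra.
Qed.

Section Potential.
Variables (R : realType) (m h : nat) (p : 'I_h -> R) (x0 : 'rV[R]_h).
Implicit Types (x y : 'M[R]_(m, h)) (d z : 'rV[R]_h) (X : 'I_m -> set 'rV[R]_h).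

(* The differential of [v |-> payoff p x0 i v x] at [v = row i x]. *)
Definition marginal (i : 'I_m) x d : R :=
  \sum_t p t * (d 0 t * (\sum_j x j t + x0 0 t + x i t)).

Definition variational_solution X x : Prop :=
  joint_set X x /\ forall i z, X i z -> 0 <= marginal i x (z - row i x).

Lemma marginalZ i x e d : marginal i x (e *: d) = e * marginal i x d.
Proof.
by rewrite /marginal mulr_sumr; apply: eq_bigr => t _; rewrite !mxE; ring.
Qed.

Lemma marginal0 i x : marginal i x 0 = 0.
Proof. by rewrite -(scale0r 0) marginalZ mul0r. Qed.

(** The pay-off is quadratic in the agent's own vector, so its second-order Taylor expansion is
    exact. *)
Lemma payoffD i x d :
  payoff p x0 i (row i x + d) x =
  payoff p x0 i (row i x) x + marginal i x d + augment p d.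
Proof.
rewrite /payoff /marginal /augment -!big_split/=; apply: eq_bigr => t _.
by rewrite !mxE (bigD1 i (P := xpredT) (F := fun j => x j t))//=; ring.
Qed.

(** At each time the external load and the agents' loads all multiply the same price; together they
    give the square of the total load. *)
Lemma objectiveE x :
  objective p x0 x =
  \sum_t p t * ((\sum_j x j t + x0 0 t) ^+ 2 + \sum_j x j t ^+ 2).
Proof.
rewrite /objective /payoff0.
under [X in _ + X]eq_bigr do rewrite /payoff /augment -big_split/=.
rewrite exchange_big/= -big_split/=; apply: eq_bigr => t _.
transitivity (x0 0 t * (p t * (\sum_j x j t + x0 0 t)) +
  \sum_i (x i t * (p t * (\sum_j x j t + x0 0 t)) + p t * x i t ^+ 2)).
  congr (_ + _); apply: eq_bigr => i _; rewrite !mxE.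
  by rewrite (bigD1 i (P := xpredT) (F := fun j => x j t))//=; ring.
by rewrite big_split/= -mulr_suml -mulr_sumr; ring.
Qed.

(** Differentiating [S t ^+ 2 + \sum_j x j t ^+ 2] in [x i t] gives [2 * (S t + x i t)], the factor
    in [marginal]; the term [x i t] comes from the augmentation. *)
Lemma objectiveD x y :
  objective p x0 (x + y) =
  objective p x0 x + 2 * (\sum_i marginal i x (row i y)) +
  \sum_t p t * ((\sum_j y j t) ^+ 2 + \sum_j y j t ^+ 2).
Proof.
rewrite !objectiveE /marginal exchange_big/= mulr_sumr -!big_split/=.
apply: eq_bigr => t _; rewrite -mulr_sumr.
under eq_bigr do rewrite mxE.
under [X in _ * (_ + X)]eq_bigr do rewrite mxE sqrrD.
under [X in 2 * (_ * X)]eq_bigr do rewrite mxE mulrDr.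
rewrite !big_split/= -mulr_suml.
have -> : \sum_j y j t * x j t = \sum_j x j t * y j t.
  by apply: eq_bigr => j _; rewrite mulrC.
by ring.
Qed.

Lemma nash_equilibrium_variational X x :
    (forall i, segment_closed (X i)) -> (forall t, 0 <= p t) ->
  nash_equilibrium (payoff p x0) X x <-> variational_solution X x.
Proof.
move=> Xc p_ge0; split=> -[Xx opt]; split=> // i z Xz.
  apply: (@linear_part_ge0 _ _ (augment p (z - row i x))) => e e01.
  have := opt i _ (Xc i _ _ _ e01 (Xx i) Xz).
  rewrite payoffD marginalZ -addrA lerDl; congr (0 <= _ + _).
  by rewrite /augment mulr_sumr; apply: eq_bigr => t _; rewrite !mxE; ring.
(* Conversely, the second-order term is a nonnegative combination of squares, so the first-order
   condition suffices. *)
rewrite -[z](subrK (row i x)) [z - _ + _]addrC payoffD -addrA lerDl.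
rewrite addr_ge0 ?opt// sumr_ge0// => t _.
by rewrite mulr_ge0 ?p_ge0 ?sqr_ge0.
Qed.

Lemma minimizer_variational X x : (forall i, segment_closed (X i)) ->
  minimizer (objective p x0) (joint_set X) x -> variational_solution X x.
Proof.
move=> Xc [Xx opt]; split=> // i z Xz.
(* A unilateral deviation of agent [i]: among the marginals in [objectiveD] only that of [i]
   survives. *)
pose y := \matrix_(j, t) if j == i then z 0 t - x i t else 0.
have row_y j : row j y = if j == i then z - row i x else 0.
  by apply/rowP => t; rewrite !mxE; case: (j == i); rewrite ?mxE.
rewrite -(pmulr_rge0 _ (ltr0n R 2)).
apply: (@linear_part_ge0 _ _
  (\sum_t p t * ((\sum_j y j t) ^+ 2 + \sum_j y j t ^+ 2))) => e e01.
have /opt : joint_set X (x + e *: y).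
  move=> j; rewrite linearD linearZ/= row_y.
  by case: eqVneq => [->|_]; [exact: Xc | rewrite scaler0 addr0].
rewrite objectiveD -addrA lerDl; congr (0 <= _ + _).
  rewrite (bigD1 i)//= big1 ?addr0 => [|j /negPf ji].
    by rewrite linearZ/= row_y eqxx marginalZ; ring.
  by rewrite linearZ/= row_y ji scaler0 marginal0.
rewrite mulr_sumr; apply: eq_bigr => t _.
under eq_bigr do rewrite mxE.
under [X in _ * (_ + X)]eq_bigr do rewrite mxE exprMn.
by rewrite -!mulr_sumr; ring.
Qed.

(** In [objectiveD] the linear term is nonnegative by the variational inequality, and the quadratic
    term vanishes only at a zero displacement. *)
Lemma variational_lt_objective X x y : (forall t, 0 < p t) ->
    variational_solution X x -> joint_set X y -> x != y ->
  objective p x0 x < objective p x0 y.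
Proof.
move=> p_gt0 [Xx opt] Xy xy.
rewrite -[y](subrK x) [y - x + x]addrC objectiveD -addrA ltrDl.
apply: ltr_wpDl.
  rewrite mulr_ge0// sumr_ge0// => i _.
  by rewrite linearB/=; apply/opt/Xy.
have term_ge0 t : 0 <= (\sum_j (y - x) j t) ^+ 2 + \sum_j (y - x) j t ^+ 2.
  by rewrite addr_ge0 ?sqr_ge0// sumr_ge0// => j _; rewrite sqr_ge0.
rewrite lt_neqAle sumr_ge0 ?andbT => [|t _]; last first.
  by rewrite mulr_ge0// ltW.
rewrite eq_sym; apply: contra xy => /eqP sum0; rewrite eq_sym -subr_eq0.
apply/eqP/matrixP => i t; rewrite [RHS]mxE.
have /(_ t isT)/eqP :=
  psumr_eq0P (fun t _ => mulr_ge0 (ltW (p_gt0 t)) (term_ge0 t)) sum0.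
rewrite mulf_eq0 gt_eqF//= paddr_eq0 ?sqr_ge0//; last first.
  by rewrite sumr_ge0// => j _; rewrite sqr_ge0.
move=> /andP[_ /eqP sq0].
have /(_ i isT)/eqP := psumr_eq0P (fun j _ => sqr_ge0 ((y - x) j t)) sq0.
by rewrite sqrf_eq0 => /eqP.
Qed.

(** The parametrization [g] allows the domain to be a product space, where Tychonoff's theorem
    applies. *)
Lemma continuous_objective (T : topologicalType) (g : T -> 'M[R]_(m, h)) :
    (forall i t, continuous (fun u => g u i t)) ->
  continuous (objective p x0 \o g).
Proof.
move=> g_cont.
have -> : objective p x0 \o g = fun u => \sum_t p t *
    ((\sum_j g u j t + x0 0 t) * (\sum_j g u j t + x0 0 t) +
      \sum_j g u j t * g u j t).
  by apply/funext => u /=; rewrite objectiveE.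
have load_cont t : continuous (fun u => \sum_j g u j t + x0 0 t).
  move=> u; apply: cvgD; last exact: cvg_cst.
  by apply: continuous_big => [|j _]; [exact: add_continuous | exact: g_cont].
apply: continuous_big => [|t _ u]; first exact: add_continuous.
apply: cvgM; first exact: cvg_cst.
apply: cvgD; first by apply: cvgM; exact: load_cont.
apply: continuous_big => [|j _ v]; first exact: add_continuous.
by apply: cvgM; exact: g_cont.
Qed.

Lemma exists_minimizer X :
    (forall i, X i !=set0) -> (forall i, compact (X i)) ->
  exists x, minimizer (objective p x0) (joint_set X) x.
Proof.
move=> X_neq0 X_compact.
(* The extreme value theorem is applied on this product of row spaces, and [mat] carries the minimum
   over to matrices. *)
pose T := prod_topology (fun _ : 'I_m => 'rV[R]_h).
pose mat (f : T) := \matrix_(i, t) f i 0 t : 'M[R]_(m, h).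
have row_mat f i : row i (mat f) = f i by apply/rowP => t; rewrite !mxE.
have coord_cont i t : continuous (fun f : T => f i 0 t).
  move=> f; apply: (@continuous_comp T _ _ (fun f => f i) (fun v => v 0 t)).
    exact: (@proj_continuous _ (fun=> 'rV[R]_h) i).
  exact: coord_continuous.
have obj_cont : continuous (objective p x0 \o mat).
  apply: continuous_objective => i t.
  rewrite (_ : (fun f : T => mat f i t) = fun f : T => f i 0 t).
    exact: coord_cont.
  by apply/funext => f; rewrite mxE.
have [f Xf opt] : exists2 f : T, f \in [set f : T | forall i, X i (f i)] &
    forall g, g \in [set f : T | forall i, X i (f i)] ->
      (objective p x0 \o mat) f <= (objective p x0 \o mat) g.
  apply: compact_EVT_min.
  - by exists (fun i => projT1 (cid (X_neq0 i))) => i; case: cid.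
  - exact: (@tychonoff _ (fun=> 'rV[R]_h) X X_compact).
  - exact: continuous_subspaceT.
exists (mat f); split=> [i|y Xy].
  by rewrite row_mat; move: Xf; rewrite inE; exact.
have -> : y = mat (fun i => row i y) by apply/matrixP => i t; rewrite !mxE.
by apply: opt; rewrite inE => i; exact: Xy.
Qed.

End Potential.

Theorem mainTheorem4 (R : realType) (m h : nat) (hm : (1 <= m)%N)
    (hh : (1 <= h)%N) (p : 'I_h -> R) (x0 : 'rV[R]_h) (gamma : 'I_m -> R)
    (lo hi : 'I_m -> 'I_h -> R)
    (X := fun i : 'I_m => agent_set (gamma i) (lo i) (hi i))
    (p_gt0 : forall t, 0 < p t) (x0_ge0 : forall t, 0 <= x0 0 t)
    (gamma_gt0 : forall i, 0 < gamma i)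
    (lo_ge0 : forall i t, 0 <= lo i t)
    (X_neq0 : forall i, X i !=set0) (X_compact : forall i, compact (X i)) :
  exists x : 'M[R]_(m, h),
    unique (nash_equilibrium (payoff p x0) X) x /\
    unique (minimizer (objective p x0) (joint_set X)) x.
Proof.
have Xc i : segment_closed (X i) by exact: segment_closed_agent_set.
have nashE x :
    nash_equilibrium (payoff p x0) X x <-> variational_solution p x0 X x.
  by apply: nash_equilibrium_variational => // t; exact: ltW.
have minE x :
    minimizer (objective p x0) (joint_set X) x -> variational_solution p x0 X x.
  exact: minimizer_variational.
have [x min_x] := exists_minimizer p x0 X_neq0 X_compact.
(* A solution other than [x] would have a strictly smaller objective than the minimizer [x].
   Equilibria and minimizers are both solutions, so this gives both uniqueness claims. *)
have uniq_x y : variational_solution p x0 X y -> x = y.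
  move=> sol_y; have [//|/eqP yx] := pselect (y = x).
  have := variational_lt_objective p_gt0 sol_y min_x.1 yx.
  by rewrite ltNge (min_x.2 _ sol_y.1).
exists x; split; split=> //.
- exact/nashE/minE.
- by move=> y /nashE/uniq_x.
- by move=> y /minE/uniq_x.
Qed.
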